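(* Let $n \geqslant 2$ and let $A \in M_n(\mathbb{C})$ be nonsingular with singular values $\sigma_1 \geqslant \sigma_2 \geqslant \cdots \geqslant \sigma_n > 0$. Let $a$ be the smallest positive solution $x$ of the equation $$x^2\left(\|A\|_F^2-x^2\right)^{n-1}=|\det A|^2(n-1)^{n-1}.$$ Then $a=\sigma_n$ if and only if $$\sigma_1=\sigma_2=\cdots=\sigma_{n-1}.$$
   Context: $M_n(\mathbb{C})$ is the space of $n\times n$ complex matrices, and $\|A\|_F=\left(\sum_{i,j=1}^n |a_{ij}|^2\right)^{1/2}$ is the Frobenius norm of $A=[a_{ij}]$. Singular values are listed in decreasing order with multiplicity. For $n=2$ the condition $\sigma_1=\cdots=\sigma_{n-1}$ is vacuously true. *)

(* Defs.v *)
From HB Require Import structures.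
From mathcomp Require Import all_boot all_order all_algebra.
From mathcomp Require Import spectral.
From mathcomp Require Import reals.
From mathcomp Require Import complex.

Set Implicit Arguments.
Unset Strict Implicit.
Unset Printing Implicit Defensive.

Import Order.TTheory GRing.Theory Num.Theory.
Local Open Scope ring_scope.
Local Open Scope sesquilinear_scope.

Definition frobenius_norm (R : realType) (n : nat) (A : 'M[R[i]]_n) : R :=
  Num.sqrt (\sum_(i < n) \sum_(j < n) Normc.normc (A i j) ^+ 2).

(* The Gram matrix A^* A is Hermitian, so [spectral_diag] lists its eigenvalues
   with multiplicity; they are real and nonnegative, and taking [Re] only
   changes their type. *)
Definition singular_values (R : realType) (n : nat) (A : 'M[R[i]]_n) : seq R :=
  sort >=%R
    [seq Num.sqrt (complex.Re (spectral_diag (A ^t* *m A) 0 i)) | i : 'I_n].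

(* Indices run from 1 to n; other values of [k] are not meaningful. *)
Definition singular_value (R : realType) (n : nat) (A : 'M[R[i]]_n) (k : nat) : R :=
  nth 0 (singular_values A) k.-1.

Definition smallest_positive (R : realType) (P : R -> Prop) (a : R) : Prop :=
  [/\ 0 < a, P a & forall x : R, 0 < x -> P x -> a <= x].

(* Main.v *)
(** The [s_i = sigma_i ^ 2] are the eigenvalues of [A^* A], so they sum to
    [||A||_F ^ 2] and have product [|det A| ^ 2]. With [m = n - 1], the equation
    at [x ^ 2 = y] reads [y (s_1 + ... + s_n - y)^m = s_1 ... s_n m^m]. At
    [y = s_n] it is the equality case of AM-GM for [s_1, ..., s_m]. Conversely,
    if [s_1 = ... = s_m], every [y] in [0 < y < s_n] makes the left-hand side
    smaller than at [y = s_n], so no positive solution lies below [sigma_n]. *)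
Require Import Defs.
From HB Require Import structures.
From mathcomp Require Import all_boot all_order all_algebra.
From mathcomp Require Import spectral.
From mathcomp Require Import reals.
From mathcomp Require Import complex.
From mathcomp Require Import ring.

Set Implicit Arguments.
Unset Strict Implicit.
Unset Printing Implicit Defensive.

Import Order.TTheory GRing.Theory Num.Theory.
Local Open Scope ring_scope.

Section Gram.
Local Open Scope sesquilinear_scope.
Variables (C : numClosedFieldType) (n : nat) (A : 'M[C]_n).
Let G := A ^t* *m A.

Lemma gram_normalmx : G \is normalmx.
Proof.
by apply/normalmxP; rewrite /G trmx_mul map_mxM !trmxCK.
Qed.

(** Writing the diagonal matrix as [B *m B ^t*] with [B = P *m A ^t*] makes each eigenvalue a sum of
    squared moduli, hence nonnegative. *)
Lemma gram_diagE : let P := spectralmx G in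
  diag_mx (spectral_diag G) = (P *m A ^t*) *m (P *m A ^t*) ^t*.
Proof.
move=> P; have /orthomx_spectralP GE := gram_normalmx.
have Pu : P \is unitarymx := spectral_unitarymx G.
have Punit : P \in unitmx := spectral_unit G.
rewrite trmx_mul map_mxM trmxCK mulmxA -(mulmxA P) -/G -invmx_unitary //.
by rewrite [in RHS]GE -/P !mulmxA mulmxV // mul1mx -mulmxA mulmxV // mulmx1.
Qed.

Lemma gram_spectral_ge0 i : 0 <= spectral_diag G 0 i.
Proof.
have /matrixP/(_ i i) := gram_diagE; rewrite /= [LHS]mxE eqxx mulr1n => ->.
by rewrite mxE sumr_ge0 // => k _; rewrite !mxE mul_conjC_ge0.
Qed.

Lemma gram_spectral_sum : \sum_i spectral_diag G 0 i = \sum_i \sum_j `|A i j| ^+ 2.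
Proof.
have /orthomx_spectralP GE := gram_normalmx.
rewrite -mxtrace_diag; transitivity (\tr G).
  by rewrite [in RHS]GE mxtrace_mulC mulmxA mulmxV ?spectral_unit // mul1mx.
rewrite /mxtrace exchange_big; apply: eq_bigr => j _; rewrite mxE.
by apply: eq_bigr => i _; rewrite !mxE normCK mulrC.
Qed.

Lemma gram_spectral_prod : \prod_i spectral_diag G 0 i = `|\det A| ^+ 2.
Proof.
have /orthomx_spectralP GE := gram_normalmx.
rewrite -det_diag; transitivity (\det G).
  rewrite [in RHS]GE !det_mulmx mulrAC -det_mulmx mulVmx ?spectral_unit //.
  by rewrite det1 mul1r.
by rewrite /G det_mulmx det_map_mx det_tr normCK mulrC.
Qed.

End Gram.

Section SingularValues.
Local Open Scope sesquilinear_scope.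
Variables (R : realType) (n : nat) (A : 'M[R[i]]_n).

Lemma size_singular_values : size (singular_values A) = n.
Proof. by rewrite size_sort size_map size_enum_ord. Qed.

Lemma singular_value_ge0 k : 0 <= singular_value A k.
Proof.
have /allP s_ge0 : all (>= 0) (singular_values A).
  by rewrite all_sort; apply/allP => _ /mapP[i _ ->]; apply: sqrtr_ge0.
rewrite /singular_value.
have [lt_ks|le_sk] := ltnP k.-1 (size (singular_values A)).
  exact/s_ge0/mem_nth.
by rewrite nth_default.
Qed.

Lemma singular_value_anti j k : (0 < j <= k)%N -> (k <= n)%N ->
  singular_value A k <= singular_value A j.
Proof.
case/andP; case: j => // j _; case: k => // k le_jk le_kn.
have ge_trans : transitive (>=%R : rel R) by move=> x y z /[swap]; apply: le_trans.
have s_sorted : sorted >=%R (singular_values A).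
  by apply: sort_sorted => x y; exact: le_total.
apply: (sorted_leq_nth ge_trans _ 0 s_sorted) => //=.
- by move=> x; exact: lexx.
- by rewrite inE size_singular_values (leq_ltn_trans _ le_kn).
- by rewrite inE size_singular_values.
Qed.

(** The eigenvalues come in no prescribed order, whereas singular values are sorted; a permutation
    is enough for symmetric functions such as the sum and the product. *)
Lemma perm_sqr_singular_values :
  perm_eq [seq singular_value A i.+1 ^+ 2 | i : 'I_n]
          [seq complex.Re (spectral_diag (A ^t* *m A) 0 i) | i : 'I_n].
Proof.
have -> : [seq singular_value A i.+1 ^+ 2 | i : 'I_n] =
    [seq x ^+ 2 | x <- singular_values A].
  rewrite -[in RHS](mkseq_nth 0 (singular_values A)) size_singular_values.
  by rewrite /mkseq -val_enum_ord -2!map_comp.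
apply: perm_trans (perm_map _ (permEl (perm_sort _ _))) _.
rewrite -map_comp.
rewrite (@eq_map _ _ _
  (fun i => complex.Re (spectral_diag (A ^t* *m A) 0 i))) //.
move=> i /=; rewrite sqr_sqrtr // -lecR.
by rewrite RRe_real ?ger0_real ?gram_spectral_ge0.
Qed.

Lemma sum_sqr_singular_value :
  \sum_(i < n) singular_value A i.+1 ^+ 2 = frobenius_norm A ^+ 2.
Proof.
rewrite sqr_sqrtr; last first.
  by apply: sumr_ge0 => i _; apply: sumr_ge0 => j _; apply: sqr_ge0.
rewrite -big_enum -(big_map _ predT id) (perm_big _ perm_sqr_singular_values).
rewrite big_map big_enum /=.
(* The eigenvalues are real, so embedding the identity into [R[i]] undoes [Re] and makes the trace
   formula applicable. *)
apply: (@complexI R); rewrite !rmorph_sum /=.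
under eq_bigr do rewrite RRe_real ?ger0_real ?gram_spectral_ge0 //.
rewrite gram_spectral_sum; apply: eq_bigr => i _; rewrite rmorph_sum.
by apply: eq_bigr => j _; rewrite rmorphXn.
Qed.

Lemma prod_sqr_singular_value :
  \prod_(i < n) singular_value A i.+1 ^+ 2 = Normc.normc (\det A) ^+ 2.
Proof.
rewrite -big_enum -(big_map _ predT id) (perm_big _ perm_sqr_singular_values).
rewrite big_map big_enum /=.
apply: (@complexI R); rewrite rmorph_prod rmorphXn /=.
under eq_bigr do rewrite RRe_real ?ger0_real ?gram_spectral_ge0 //.
exact: gram_spectral_prod.
Qed.

(** A zero singular value would annihilate the product, which is the squared modulus of a nonzero
    determinant. *)
Lemma singular_value_gt0 k : A \in unitmx -> (0 < k <= n)%N ->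
  0 < singular_value A k.
Proof.
case: k => // k; rewrite unitmxE unitfE => detA_neq0 lt_kn.
rewrite lt0r singular_value_ge0 andbT; apply: contraNneq detA_neq0 => sk0.
apply/eqP/Normc.eq0_normc/eqP; rewrite -sqrf_eq0 -prod_sqr_singular_value.
by apply/prodf_eq0; exists (Ordinal lt_kn); rewrite //= sk0 expr0n.
Qed.

End SingularValues.

(** By induction: (1 + x)(1 - (k+1)x) = 1 - kx - (k+1)x^2, so raising [k] never increases the
    product; strictness comes from 1 - x^2 < 1 at [k = 1]. *)
Lemma expr_1Dx_mul_1Bnx_lt1 (R : realDomainType) (x : R) (k : nat) :
  0 < x -> (0 < k)%N -> (1 + x) ^+ k * (1 - k%:R * x) < 1.
Proof.
move=> x_gt0; elim: k => // -[|k] IHk _.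
  by rewrite expr1 mul1r mulrC -subr_sqr expr1n ltrBlDr ltrDl exprn_gt0.
apply: le_lt_trans (IHk isT); rewrite exprSr -mulrA ler_pM2l ?exprn_gt0 //.
  rewrite -subr_ge0 [leRHS](_ : _ = k.+2%:R * x ^+ 2).
    by rewrite mulr_ge0 ?ler0n ?sqr_ge0.
  by rewrite -[k.+2%:R]natr1; ring.
by rewrite ltr_pwDl ?ltr01 // ltW.
Qed.

(** Here [s] stands for the common value of the [m] largest squares and [t] for the smallest square.
    Dividing by [(s *+ m) ^+ m] reduces the claim to y(1 + v)^m < t with v = (t - y)/(ms). *)
Lemma mul_exp_addB_lt (R : realFieldType) (m : nat) (s t y : R) :
  (0 < m)%N -> 0 < y -> y < t -> t <= s ->
  y * (s *+ m + t - y) ^+ m < t * (s *+ m) ^+ m.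
Proof.
move=> m_gt0 y_gt0 y_lt_t t_le_s.
have t_gt0 : 0 < t := lt_trans y_gt0 y_lt_t.
have s_gt0 : 0 < s := lt_le_trans t_gt0 t_le_s.
have sm_gt0 : 0 < s *+ m by rewrite pmulrn_lgt0.
pose v := (t - y) / (s *+ m).
have v_gt0 : 0 < v by rewrite divr_gt0 ?subr_gt0.
have -> : s *+ m + t - y = s *+ m * (1 + v).
  by rewrite /v mulrDr mulr1 mulrCA divff ?gt_eqF // mulr1 addrA.
have mvE : m%:R * v = (t - y) / s.
  by rewrite /v -mulr_natr; field; rewrite gt_eqF //= pnatr_eq0 -lt0n.
(* This is where [t <= s] enters: t(t - y)/s is at most t - y. *)
have y_le : y <= t * (1 - m%:R * v).
  rewrite mvE mulrBr mulr1 lerBrDr -lerBrDl mulrCA ger_pMr ?subr_gt0 //.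
  by rewrite ler_pdivrMr ?mul1r.
rewrite exprMn mulrCA [ltRHS]mulrC ltr_pM2l ?exprn_gt0 //.
have v1_gt0 : 0 < (1 + v) ^+ m by rewrite exprn_gt0 // addr_gt0.
apply: le_lt_trans (_ : t * ((1 + v) ^+ m * (1 - m%:R * v)) < t).
  by rewrite mulrCA mulrC ler_pM2l.
by rewrite gtr_pMr // expr_1Dx_mul_1Bnx_lt1.
Qed.

Theorem proposition1 (R : realType) (n : nat) (A : 'M[R[i]]_n) (a : R)
    (n_ge2 : (2 <= n)%N) (A_nonsingular : A \in unitmx)
    (a_smallest : smallest_positive
       (fun x : R => x ^+ 2 * (frobenius_norm A ^+ 2 - x ^+ 2) ^+ n.-1
                     = Normc.normc (\det A) ^+ 2 * n.-1%:R ^+ n.-1) a) :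
  a = singular_value A n <->
  (forall i j : nat, (1 <= i <= n.-1)%N -> (1 <= j <= n.-1)%N ->
     singular_value A i = singular_value A j).
Proof.
case: a_smallest => a_gt0 a_root a_min.
have sv_gt0 k := singular_value_gt0 (k := k) A_nonsingular.
move: sv_gt0 (@singular_value_anti _ _ A).
move: a_root a_min; rewrite -sum_sqr_singular_value -prod_sqr_singular_value.
(* The matrix is now forgotten: [sv] is known only through the equation, the minimality of [a],
   positivity and monotonicity. *)
move: (singular_value A) => sv.
case: n n_ge2 A A_nonsingular => // m m_gt0 _ _ /=.
rewrite ltnS in m_gt0; rewrite !big_ord_recr /=.
set S := \sum_(i < m) _; set P := \prod_(i < m) _; set t := sv m.+1.
move=> a_root a_min sv_gt0 sv_anti.
have t_gt0 : 0 < t by apply: sv_gt0; rewrite ltnS leqnn.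
have svP (i : 'I_m) : 0 <= sv i.+1 := ltW (sv_gt0 i.+1 (ltnW (ltn_ord i))).
have m_neq0 : (m%:R : R) != 0 by rewrite pnatr_eq0 -lt0n.
split=> [a_eq | sv_eq].
- have tt_neq0 : t ^+ 2 != 0 by rewrite sqrf_eq0 gt_eqF.
  have SP : S ^+ m = P * m%:R ^+ m.
    move: a_root; rewrite a_eq addrK => root_t.
    by apply: (mulfI tt_neq0); rewrite root_t [RHS]mulrCA mulrA.
  (* [SP] says that [P] is the [m]-th power of the mean [S / m], so the equality condition of AM-GM
     forces the squares to agree. *)
  have [_] := @leif_AGM R 'I_m predT (fun i => sv i.+1 ^+ 2)
                (fun i _ => sqr_ge0 _).
  rewrite /= card_ord -/S -/P expr_div_n SP mulfK ?expf_neq0 // eqxx => /esym.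
  move=> /forall_inP all_eq i j; case: i => // i; case: j => // j /= lt_im lt_jm.
  have /forall_inP/(_ (Ordinal lt_jm) isT) := all_eq (Ordinal lt_im) isT.
  by rewrite /= eqrXn2 ?(svP (Ordinal _)) => // /eqP.
pose s := sv 1%N ^+ 2.
have svE (i : 'I_m) : sv i.+1 ^+ 2 = s by rewrite (sv_eq _ 1%N) //= ltn_ord.
have SE : S = s *+ m.
  by rewrite /S (eq_bigr _ (fun i _ => svE i)) sumr_const card_ord.
have PE : P = s ^+ m.
  by rewrite /P (eq_bigr _ (fun i _ => svE i)) prodr_const card_ord.
have smE : (s *+ m) ^+ m = P * m%:R ^+ m by rewrite PE -mulr_natr exprMn.
(* With equal squares, [t] is itself a solution, so the minimality of [a] applies. *)
have a_le_t : a <= t.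
  by apply: a_min => //; rewrite SE addrK smE mulrCA mulrA.
apply/eqP; rewrite eq_le a_le_t leNgt /=; apply/negP => a_lt_t.
have t_le_s : t ^+ 2 <= s.
  by rewrite lerXn2r ?nnegrE ?sv_anti ?(ltW (sv_gt0 _ _)) /= ?leqnn.
have aa_lt : a ^+ 2 < t ^+ 2 by rewrite ltr_sqr ?nnegrE ?ltW.
have aa_gt0 : 0 < a ^+ 2 by rewrite exprn_gt0.
(* Both [a] and [t] solve the equation, so the two sides of this strict inequality are equal, a
   contradiction. *)
have := mul_exp_addB_lt m_gt0 aa_gt0 aa_lt t_le_s.
by rewrite -SE a_root SE smE [ltRHS]mulrCA mulrA ltxx.
Qed.
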